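(* The Mandelbrot set $\mathcal{M}_{\mathrm{Im}\mathbb{H}}^{(2,1)}$ has the same dynamics as the 3D slice $\mathcal{H}(1,i,j)$ of the quaternionic Mandelbrot set, in the following sense: for all $a,b,c\in\mathbb{R}$, putting $q=ak+bi+cj\in\mathrm{Im}\,\mathbb{H}$ and $p=a+bi+cj\in\mathbb{H}$, for every $n\ge 1$ there are $x_n,y_n,z_n\in\mathbb{R}$ with $$Q_q^{(n)}(0)=x_n k+y_n i+z_n j\quad\text{and}\quad P_p^{(n)}(0)=x_n+y_n i+z_n j;$$ consequently $ak+bi+cj\in\mathcal{M}_{\mathrm{Im}\mathbb{H}}^{(2,1)}$ if and only if $a+bi+cj\in\mathcal{H}(1,i,j)$.
   Context: $\mathbb{H}$ denotes the quaternions (with $i^2=j^2=k^2=ijk=-1$) and $\mathrm{Im}\,\mathbb{H}=\{ai+bj+ck : a,b,c\in\mathbb{R}\}$ the pure quaternions, with Euclidean norm. Unique spherical representation: every $q\in\mathrm{Im}\,\mathbb{H}$ is written $q=\rho(i\sin\phi\cos\theta+j\sin\phi\sin\theta+k\cos\phi)$ with $\rho=\|q\|\ge 0$, $0\le\theta<2\pi$, $0\le\phi\le\pi$; the triple $(\rho,\theta,\phi)$ is made unique by the conventions: for $q=0$ take $\theta=\phi=0$; for $q=ck$ with $c>0$ take $(c,0,0)$; for $q=ck$ with $c<0$ take $(|c|,0,\pi)$. For this representation, define $$q\times_s^{(2,1)}q:=\rho^2\big(i\sin(2\phi)\cos(\theta)+j\sin(2\phi)\sin(\theta)+k\cos(2\phi)\big).$$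 For $c\in\mathrm{Im}\,\mathbb{H}$ let $Q_c(q)=q\times_s^{(2,1)}q+c$ on $\mathrm{Im}\,\mathbb{H}$ and let $Q_c^{(n)}$ be its $n$-fold composition; $\mathcal{M}_{\mathrm{Im}\mathbb{H}}^{(2,1)}:=\{c\in\mathrm{Im}\,\mathbb{H} : \{Q_c^{(n)}(0)\}_{n\in\mathbb{N}}\text{ is bounded}\}$. For $c\in\mathbb{H}$ let $P_c(z)=z^2+c$ on $\mathbb{H}$ (quaternion product), with $n$-fold composition $P_c^{(n)}$. The 3D slice is $\mathcal{H}(1,i,j)=\{c\in\mathrm{span}_{\mathbb{R}}\{1,i,j\} : \{P_c^{(n)}(0)\}_{n\in\mathbb{N}}\text{ is bounded}\}$. *)

(* Defs.v *)
From HB Require Import structures.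
From mathcomp Require Import all_boot all_order all_algebra ring lra.
From mathcomp Require Import boolp classical_sets reals trigo.

Set Implicit Arguments.
Unset Strict Implicit.
Unset Printing Implicit Defensive.

Import Order.TTheory GRing.Theory Num.Theory.
Local Open Scope classical_set_scope.
Local Open Scope ring_scope.

Record quat (R : realType) := Quat { re : R; im1 : R; im2 : R; im3 : R }.
Add Printing Constructor quat.

Definition tuple_of_quat (R : realType) (q : quat R) : R * R * R * R :=
  (re q, im1 q, im2 q, im3 q).
Definition quat_of_tuple (R : realType) (t : R * R * R * R) : quat R :=
  let: (a, b, c, d) := t in Quat a b c d.

Lemma tuple_of_quatK (R : realType) :
  cancel (@tuple_of_quat R) (@quat_of_tuple R).
Proof. by case. Qed.

HB.instance Definition _ (R : realType) :=
  Choice.copy (quat R) (can_type (@tuple_of_quatK R)).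

Definition addq (R : realType) (p q : quat R) :=
  Quat (re p + re q) (im1 p + im1 q) (im2 p + im2 q) (im3 p + im3 q).

Definition oppq (R : realType) (q : quat R) :=
  Quat (- re q) (- im1 q) (- im2 q) (- im3 q).

Definition mulq (R : realType) (p q : quat R) :=
  let: Quat a b c d := p in let: Quat a' b' c' d' := q in
  Quat (a * a' - b * b' - c * c' - d * d')
       (a * b' + b * a' + c * d' - d * c')
       (a * c' - b * d' + c * a' + d * b')
       (a * d' + b * c' - c * b' + d * a').

Definition scaleq (R : realType) (x : R) (q : quat R) :=
  Quat (x * re q) (x * im1 q) (x * im2 q) (x * im3 q).

Definition oneq (R : realType) : quat R := Quat 1 0 0 0.

Lemma addqA (R : realType) : associative (@addq R).
Proof. by case=> a b c d [? ? ? ?] [? ? ? ?]; congr Quat; rewrite /= addrA. Qed.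
Lemma addqC (R : realType) : commutative (@addq R).
Proof. by case=> a b c d [? ? ? ?]; congr Quat; rewrite /= addrC. Qed.
Lemma add0q (R : realType) : left_id (Quat 0 0 0 0) (@addq R).
Proof. by case=> a b c d; congr Quat; rewrite /= add0r. Qed.
Lemma addNq (R : realType) : left_inverse (Quat 0 0 0 0) (@oppq R) (@addq R).
Proof. by case=> a b c d; congr Quat; rewrite /= addNr. Qed.

HB.instance Definition _ (R : realType) :=
  GRing.isZmodule.Build (quat R) (@addqA R) (@addqC R) (@add0q R) (@addNq R).

Lemma mulqA (R : realType) : associative (@mulq R).
Proof. by case=> ? ? ? ? [? ? ? ?] [? ? ? ?]; congr Quat; ring. Qed.
Lemma mul1q (R : realType) : left_id (oneq R) (@mulq R).
Proof. by case=> ? ? ? ?; congr Quat; ring. Qed.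
Lemma mulq1 (R : realType) : right_id (oneq R) (@mulq R).
Proof. by case=> ? ? ? ?; congr Quat; ring. Qed.
Lemma mulqDl (R : realType) : left_distributive (@mulq R) +%R.
Proof. by case=> ? ? ? ? [? ? ? ?] [? ? ? ?]; congr Quat => /=; ring. Qed.
Lemma mulqDr (R : realType) : right_distributive (@mulq R) +%R.
Proof. by case=> ? ? ? ? [? ? ? ?] [? ? ? ?]; congr Quat => /=; ring. Qed.
Lemma oneq_neq0 (R : realType) : oneq R != 0.
Proof. by apply/eqP => -[] /eqP; rewrite oner_eq0. Qed.

HB.instance Definition _ (R : realType) :=
  GRing.Zmodule_isNzRing.Build (quat R)
    (@mulqA R) (@mul1q R) (@mulq1 R) (@mulqDl R) (@mulqDr R) (oneq_neq0 R).

Lemma scaleqA (R : realType) (x y : R) (q : quat R) :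
  scaleq x (scaleq y q) = scaleq (x * y) q.
Proof. by congr Quat; rewrite /= mulrA. Qed.
Lemma scale1q (R : realType) : left_id 1 (@scaleq R).
Proof. by case=> a b c d; congr Quat; rewrite /= mul1r. Qed.
Lemma scaleqDr (R : realType) : right_distributive (@scaleq R) +%R.
Proof. by move=> x p q; congr Quat; rewrite /= mulrDr. Qed.
Lemma scaleqDl (R : realType) (q : quat R) :
  {morph (@scaleq R)^~ q : x y / x + y}.
Proof. by move=> x y; congr Quat; rewrite /= mulrDl. Qed.

HB.instance Definition _ (R : realType) :=
  GRing.Zmodule_isLmodule.Build R (quat R)
    (@scaleqA R) (@scale1q R) (@scaleqDr R) (@scaleqDl R).

Lemma scaleqAl (R : realType) (x : R) (p q : quat R) :
  x *: (p * q) = (x *: p) * q.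
Proof. by case: p q => ? ? ? ? [? ? ? ?]; congr Quat => /=; ring. Qed.
Lemma scaleqAr (R : realType) (x : R) (p q : quat R) :
  x *: (p * q) = p * (x *: q).
Proof. by case: p q => ? ? ? ? [? ? ? ?]; congr Quat => /=; ring. Qed.

HB.instance Definition _ (R : realType) :=
  GRing.Lmodule_isLalgebra.Build R (quat R) (@scaleqAl R).
HB.instance Definition _ (R : realType) :=
  GRing.Lalgebra_isAlgebra.Build R (quat R) (@scaleqAr R).

Definition qi {R : realType} : quat R := Quat 0 1 0 0.
Definition qj {R : realType} : quat R := Quat 0 0 1 0.
Definition qk {R : realType} : quat R := Quat 0 0 0 1.

Lemma hamilton_relations (R : realType) :
  [/\ qi ^+ 2 = -1 :> quat R, qj ^+ 2 = -1 :> quat R,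
      qk ^+ 2 = -1 :> quat R & qi * qj * qk = -1 :> quat R].
Proof. by split; rewrite ?expr2; congr Quat => /=; ring. Qed.

Lemma quatE (R : realType) (q : quat R) :
  q = re q *: 1 + im1 q *: qi + im2 q *: qj + im3 q *: qk.
Proof. by case: q => a b c d; congr Quat => /=; ring. Qed.

Definition qnorm (R : realType) (q : quat R) : R :=
  Num.sqrt (re q ^+ 2 + im1 q ^+ 2 + im2 q ^+ 2 + im3 q ^+ 2).

Definition ImH (R : realType) : set (quat R) :=
  [set q | exists a b c : R, q = a *: qi + b *: qj + c *: qk].

Definition sph (R : realType) (rho theta phi : R) : quat R :=
  rho *: ((sin phi * cos theta) *: qi + (sin phi * sin theta) *: qj
          + cos phi *: qk).

(* The triple [t = (rho, theta, phi)] is the normalized spherical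
   representation of [q]. *)
Definition spherical_rep (R : realType) (q : quat R) (t : R * R * R) : Prop :=
  let: (rho, theta, phi) := t in
  [/\ q = sph rho theta phi,
      rho = qnorm q,
      0 <= theta < 2 * pi,
      0 <= phi <= pi &
      [/\ q = 0 -> theta = 0 /\ phi = 0,
          forall c : R, 0 < c -> q = c *: qk -> t = (c, 0, 0) &
          forall c : R, c < 0 -> q = c *: qk -> t = (`|c|, 0, pi)]].

Lemma cos_sin_inj (R : realType) (s t : R) :
  0 <= s < 2 * pi -> 0 <= t < 2 * pi ->
  cos s = cos t -> sin s = sin t -> s = t.
Proof.
wlog le_st : s t / s <= t.
  move=> hw hs ht hc hn; have [/hw|/ltW/hw h] := leP s t; first exact.
  by apply/esym/h.
move=> /andP[s0 s2] /andP[t0 t2] hc hn.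
apply/eqP; rewrite eq_le le_st /= leNgt; apply/negP => lt_st.
pose d := (t - s) / 2.
have dE : t - s = d *+ 2 by rewrite -mulr_natr /d divfK // pnatr_eq0.
have d0 : 0 < d by rewrite divr_gt0 // subr_gt0.
have dpi : d < pi.
  by rewrite ltr_pdivrMr // mulrC; apply: le_lt_trans t2; rewrite lerBlDr lerDl.
have := sin_gt0_pi; move=> /(_ R d); rewrite d0 dpi => /(_ isT) sd0.
have := cosB t s; rewrite dE cos_mulr2n cos2sin2 hc hn -!expr2 cos2Dsin2 => h.
have : sin d ^+ 2 = 0 by move: h; rewrite mulr2n; lra.
by move/eqP; rewrite expf_eq0 /= gt_eqF.
Qed.

Lemma spherical_repP (R : realType) (q : quat R) :
  ImH q -> exists! t, spherical_rep q t.
Proof.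
move=> [x [y [z]]] qE.
have {}qE : q = Quat 0 x y z by rewrite qE; congr Quat => /=; ring.
have sphE rho theta phi : sph rho theta phi =
    Quat 0 (rho * (sin phi * cos theta)) (rho * (sin phi * sin theta))
         (rho * cos phi) :> quat R.
  by congr Quat => /=; ring.
have kE (c : R) : c *: qk = Quat 0 0 0 c by congr Quat => /=; ring.
have qnE : qnorm q = Num.sqrt (x ^+ 2 + y ^+ 2 + z ^+ 2).
  by rewrite qE /qnorm /= expr0n /= add0r.
have pi0 := @pi_gt0 R.
have [s0|s_neq0] := eqVneq (x ^+ 2 + y ^+ 2) 0.
  have x0 : x = 0 by nra.
  have y0 : y = 0 by nra.
  have qnz : qnorm q = `|z| by rewrite qnE s0 add0r sqrtr_sqr.
  have qz : q = z *: qk by rewrite kE qE x0 y0.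
  have k_inj (c : R) : q = c *: qk -> c = z.
    by rewrite qE kE => -[].
  have [z_lt|z_gt|z0] := ltgtP z 0.
  - exists (`|z|, 0, pi); split; last first.
      by move=> [[r th] ph] [_ _ _ _ [_ _ /(_ z z_lt qz) ->]].
    split=> //.
    + by rewrite sphE sinpi cospi qE x0 y0 ltr0_norm //; congr Quat; ring.
    + by rewrite lexx mulr_gt0.
    + by rewrite ltW //=.
    + split.
      * by rewrite qE => -[_ _ h]; move: z_lt; rewrite h ltxx.
      * by move=> c c0 /k_inj cz; move: c0; rewrite cz ltNge ltW.
      * by move=> c c0 /k_inj ->.
  - exists (z, 0, 0); split; last first.
      by move=> [[r th] ph] [_ _ _ _ [_ /(_ z z_gt qz) -> _]].
    split=> //.
    + by rewrite sphE sin0 cos0 qE x0 y0; congr Quat; ring.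
    + by rewrite qnz gtr0_norm.
    + by rewrite lexx mulr_gt0.
    + by rewrite lexx ltW.
    + split=> //.
      * by move=> c c0 /k_inj ->.
      * by move=> c c0 /k_inj cz; move: c0; rewrite cz ltNge ltW.
  - have q0 : q = 0 by rewrite qE x0 y0 z0.
    exists (0, 0, 0); split; last first.
      move=> [[r th] ph] [_ + _ _ [/(_ q0)[-> ->] _ _]].
      by rewrite qnz z0 normr0 => ->.
    split=> //.
    + by rewrite sphE sin0 cos0 qE x0 y0 z0; congr Quat; ring.
    + by rewrite qnz z0 normr0.
    + by rewrite lexx mulr_gt0.
    + by rewrite lexx ltW.
    + split=> //; move=> c c0 /k_inj cz; move: c0; rewrite cz z0 ltxx //.
have s_gt0 : 0 < x ^+ 2 + y ^+ 2.
  by rewrite lt_neqAle eq_sym s_neq0 addr_ge0 ?sqr_ge0.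
have conv (t : R * R * R) : [/\ q = 0 -> t.1.2 = 0 /\ t.2 = 0,
    forall c : R, 0 < c -> q = c *: qk -> t = (c, 0, 0) &
    forall c : R, c < 0 -> q = c *: qk -> t = (`|c|, 0, pi)].
  split; first by rewrite qE => -[x0 y0 _]; move: s_neq0; rewrite x0 y0 expr0n addr0 eqxx.
    by move=> c _; rewrite qE kE => -[x0 y0 _]; move: s_neq0; rewrite x0 y0 expr0n addr0 eqxx.
  by move=> c _; rewrite qE kE => -[x0 y0 _]; move: s_neq0; rewrite x0 y0 expr0n addr0 eqxx.
pose r := Num.sqrt (x ^+ 2 + y ^+ 2 + z ^+ 2).
pose s := Num.sqrt (x ^+ 2 + y ^+ 2).
have rr : r ^+ 2 = x ^+ 2 + y ^+ 2 + z ^+ 2.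
  by rewrite sqr_sqrtr // !addr_ge0 ?sqr_ge0.
have ss : s ^+ 2 = x ^+ 2 + y ^+ 2 by rewrite sqr_sqrtr // ltW.
have r_gt0 : 0 < r by rewrite sqrtr_gt0 ltr_wpDr ?sqr_ge0.
have s_gt : 0 < s by rewrite sqrtr_gt0.
have unit_bound (u v : R) : u ^+ 2 + v ^+ 2 = 1 -> -1 <= u <= 1.
  by move=> h; have := sqr_ge0 v; have := sqr_ge0 u => u0 v0; apply/andP; split; nra.
have hz : (z / r) ^+ 2 + (s / r) ^+ 2 = 1.
  rewrite !expr_div_n -mulrDl rr ss addrC divff // -rr.
  by rewrite expf_neq0 // gt_eqF.
have hu : (x / s) ^+ 2 + (y / s) ^+ 2 = 1.
  rewrite !expr_div_n -mulrDl ss divff //.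
have bz := unit_bound _ _ hz.
have bu := unit_bound _ _ hu.
pose phi := acos (z / r).
have cphi : cos phi = z / r by rewrite acosK // in_itv.
have sphi : sin phi = s / r.
  rewrite sin_acos // -hz addrAC subrr add0r sqrtr_sqr ger0_norm //.
  by rewrite divr_ge0 // ltW.
pose th0 := acos (x / s).
have cth0 : cos th0 = x / s by rewrite acosK // in_itv.
have sth0 : sin th0 = `|y / s|.
  by rewrite sin_acos // -hu addrAC subrr add0r sqrtr_sqr.
have th0_ge : 0 <= th0 by exact: acos_ge0.
have th0_le : th0 <= pi by exact: acos_lepi.
have [theta [tb ct st]] : exists theta,
    [/\ 0 <= theta < 2 * pi, cos theta = x / s & sin theta = y / s].
  have [y0|y0] := leP 0 (y / s).
    exists th0; split=> //; last by rewrite sth0 ger0_norm.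
    by rewrite th0_ge /=; lra.
  exists (2 * pi - th0); split.
  - have : 0 < th0.
      rewrite lt_neqAle th0_ge andbT; apply/eqP => h.
      by move: sth0 y0; rewrite -h sin0 => /esym/eqP; rewrite normr_eq0 => /eqP ->; rewrite ltxx.
    by move=> ?; apply/andP; split; lra.
  - by rewrite mulr_natl cosB cos2pi sin2pi mul1r mul0r addr0.
  - rewrite mulr_natl sinB cos2pi sin2pi mul1r mul0r sub0r sth0.
    by rewrite ltr0_norm // opprK.
have r_neq0 : r != 0 by rewrite gt_eqF.
have sn0 : s != 0 by rewrite gt_eqF.
exists (r, theta, phi); split.
  split; [|by rewrite qnE | by [] | by rewrite acos_ge0 ?acos_lepi | exact: (conv (r, theta, phi))].
  by rewrite sphE cphi sphi ct st qE; congr Quat; field; rewrite ?r_neq0 ?sn0.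
move=> [[r' th'] ph'] [qE' r'E tb' /andP[pb0 pb1] _].
have {}r'E : r' = r by rewrite r'E qnE.
rewrite {}r'E in qE' *.
move: qE'; rewrite qE sphE => -[xE yE zE].
have cphi' : cos ph' = z / r by rewrite zE mulrAC divff ?mul1r.
have phE : phi = ph'.
  apply: cos_inj; rewrite ?in_itv /= ?pb0 ?pb1 ?acos_ge0 ?acos_lepi //.
  by rewrite cphi.
rewrite -phE; congr (_, _, _).
rewrite -phE sphi in xE yE.
apply: cos_sin_inj => //.
  by rewrite ct xE; field; rewrite ?r_neq0 ?sn0.
by rewrite st yE; field; rewrite ?r_neq0 ?sn0.
Qed.

(* By [spherical_repP] this is the unique normalized representation when
   [q] is in [ImH]; the value is irrelevant otherwise. *)
Definition spherical (R : realType) (q : quat R) : R * R * R :=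
  xget (0, 0, 0) (spherical_rep q).

Definition sqr_s21 (R : realType) (q : quat R) : quat R :=
  let: (rho, theta, phi) := spherical q in
  rho ^+ 2 *: ((sin (2 * phi) * cos theta) *: qi
               + (sin (2 * phi) * sin theta) *: qj
               + cos (2 * phi) *: qk).

Definition Qmap (R : realType) (c q : quat R) : quat R := sqr_s21 q + c.

Definition Pmap (R : realType) (c z : quat R) : quat R := z ^+ 2 + c.

Definition bounded_orbit (R : realType) (f : quat R -> quat R) : Prop :=
  has_ubound (range (fun n : nat => qnorm (iter n f 0))).

Definition mandelbrot_ImH21 (R : realType) : set (quat R) :=
  [set c | ImH c /\ bounded_orbit (Qmap c)].

Definition slice_1ij (R : realType) : set (quat R) :=
  [set c | (exists x y z : R, c = x *: 1 + y *: qi + z *: qj)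
           /\ bounded_orbit (Pmap c)].

(* Main.v *)
(** Writing [q = x k + y i + z j] in spherical coordinates, [x = rho cos phi],
    [y = rho sin phi cos theta] and [z = rho sin phi sin theta], so doubling
    [phi] while squaring [rho] gives
    [(x^2 - y^2 - z^2) k + 2xy i + 2xz j]: the quaternion square of
    [x + y i + z j] with [1] replaced by [k].  This replacement is an additive
    isometry, hence it conjugates the two dynamics. *)
Require Import Defs.
From mathcomp Require Import all_boot all_order all_algebra ring.
From mathcomp Require Import boolp classical_sets reals trigo.

Import GRing.Theory.
Local Open Scope ring_scope.

Lemma ijk_quatE (R : realType) (x y z : R) :
  x *: qk + y *: qi + z *: qj = Quat 0 y z x.
Proof. by congr Quat => /=; ring. Qed.

Lemma ij1_quatE (R : realType) (x y z : R) :
  x *: 1 + y *: qi + z *: qj = Quat x y z 0.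
Proof. by congr Quat => /=; ring. Qed.

Lemma ImH_Quat (R : realType) (x y z : R) : ImH (Quat 0 y z x).
Proof. by exists y, z, x; congr Quat => /=; ring. Qed.

(** The angles are never computed: the equation [q = sph rho theta phi] eliminates [x], [y], [z],
    and the double-angle formulas in [phi] do the rest. *)
Lemma sqr_s21_Quat (R : realType) (x y z : R) :
  sqr_s21 (Quat 0 y z x) =
  Quat 0 (2 * x * y) (2 * x * z) (x ^+ 2 - y ^+ 2 - z ^+ 2).
Proof.
have [t [ht _]] := spherical_repP (ImH_Quat _ x y z).
(* Existence ensures that [xget] returns a genuine representation, not the default triple. *)
have := xgetPex (0, 0, 0) (ex_intro _ t ht).
rewrite /sqr_s21 /spherical.
case: (xget _ _) => [[rho theta] phi] [+ _ _ _ _].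
have -> : sph rho theta phi = Quat 0 (rho * (sin phi * cos theta))
    (rho * (sin phi * sin theta)) (rho * cos phi).
  by congr Quat => /=; ring.
case=> -> -> ->.
have s2 : sin (2 * phi) = 2 * (cos phi * sin phi).
  by rewrite !mulr_natl sin_mulr2n.
have c2 : cos (2 * phi) = cos phi ^+ 2 - sin phi ^+ 2.
  by rewrite mulr_natl cos_mulr2n cos2sin2; ring.
rewrite s2 c2; congr Quat => /=; try ring.
(* In the [qk] coordinate [theta] must cancel, by the Pythagorean identity. *)
rewrite !exprMn (sin2cos2 theta); ring.
Qed.

Lemma sqr_Quat (R : realType) (x y z : R) :
  Quat x y z 0 ^+ 2 =
  Quat (x ^+ 2 - y ^+ 2 - z ^+ 2) (2 * x * y) (2 * x * z) 0.
Proof. by rewrite expr2; congr Quat => /=; ring. Qed.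

(** The case [n = 0] starts the induction, and [bounded_orbit] ranges over it too. *)
Lemma iter_Qmap_Pmap (R : realType) (a b c : R) (n : nat) :
  exists x y z : R,
    iter n (Qmap (Quat 0 b c a)) 0 = Quat 0 y z x /\
    iter n (Pmap (Quat a b c 0)) 0 = Quat x y z 0.
Proof.
elim: n => [|n [x [y [z [Qn Pn]]]]]; first by exists 0, 0, 0.
exists (x ^+ 2 - y ^+ 2 - z ^+ 2 + a), (2 * x * y + b), (2 * x * z + c).
rewrite !iterS Qn Pn /Qmap /Pmap sqr_s21_Quat sqr_Quat.
by split; congr Quat; rewrite /= addr0.
Qed.

Lemma qnorm_Quat_swap (R : realType) (x y z : R) :
  qnorm (Quat 0 y z x) = qnorm (Quat x y z 0).
Proof. by rewrite /qnorm /=; congr Num.sqrt; ring. Qed.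

Lemma bounded_orbit_Qmap_Pmap (R : realType) (a b c : R) :
  bounded_orbit (Qmap (Quat 0 b c a)) <-> bounded_orbit (Pmap (Quat a b c 0)).
Proof.
rewrite /bounded_orbit.
(* The orbits have equal norms term by term, so the two ranges are the same set. *)
suff -> : (fun n => qnorm (iter n (Qmap (Quat 0 b c a)) 0)) =
          (fun n => qnorm (iter n (Pmap (Quat a b c 0)) 0)) by [].
apply/funext => n.
by have [x [y [z [-> ->]]]] := iter_Qmap_Pmap _ a b c n; exact: qnorm_Quat_swap.
Qed.

Theorem theorem15 (R : realType) (a b c : R) :
  let q : quat R := a *: qk + b *: qi + c *: qj in
  let p : quat R := a *: 1 + b *: qi + c *: qj in
  (forall n : nat, (1 <= n)%N ->
     exists x y z : R,
       iter n (Qmap q) 0 = x *: qk + y *: qi + z *: qj /\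
       iter n (Pmap p) 0 = x *: 1 + y *: qi + z *: qj) /\
  (mandelbrot_ImH21 q <-> slice_1ij p).
Proof.
move=> q p; rewrite /q /p ijk_quatE ij1_quatE; split=> [n _|].
  have [x [y [z [Qn Pn]]]] := iter_Qmap_Pmap _ a b c n.
  by exists x, y, z; rewrite ijk_quatE ij1_quatE.
(* Boundedness transfers; membership in the span or in [ImH] is read off the coordinates. *)
split=> -[_ /bounded_orbit_Qmap_Pmap orb]; split=> //.
  by exists a, b, c; rewrite ij1_quatE.
exact: ImH_Quat.
Qed.
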